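(* Let $X$ be a countably infinite set, let $f:X\to X$ be a map satisfying the bounded condition, with $X_1,\dots,X_k$ ($k\ge 1$) pairwise disjoint subsets of $X$ such that $\bigcup_{i=1}^kX_i=X$ and each $f|_{X_i}$ is injective. Let $\mathcal{H}$ be a complex Hilbert space with orthonormal basis $\{e_x\}_{x\in X}$, and for $1\le i\le k$ let $T_i\in\mathcal{B}(\mathcal{H})$ be the partial isometry determined by $T_ie_x=e_{f(x)}$ if $x\in X_i$ and $T_ie_x=0$ if $x\notin X_i$. If $C^{*}(T_1,T_2,\dots,T_k)$ has no non-trivial reducing subspaces, then $x\sim y$ for every $x,y\in X$.
   Context: $f$ satisfies the bounded condition if such finitely many pairwise disjoint sets $X_1,\dots,X_k$ exist; they are fixed. The orbit of $x$ is $\operatorname{orb}(x;f)=\{f^n(x)\mid n\ge 0\}$, with $f^0=\mathrm{id}_X$, and $\sim$ is the orbit equivalence relation by $f$: $x\sim y$ iff $\operatorname{orb}(x;f)\cap\operatorname{orb}(y;f)\neq\emptyset$. $\mathcal{B}(\mathcal{H})$ is the algebra of bounded linear operators on $\mathcal{H}$. A $C^*$-algebra in $\mathcal{B}(\mathcal{H})$ is a norm-closed linear subspace closed under products and adjoints; $C^*(T_1,\dots,T_k)$ is the $C^*$-algebra generated by $T_1,\dots,T_k$, i.e. the smallest one containing them. A reducing subspace of a $C^*$-algebra $\mathcal{A}\subseteq\mathcal{B}(\mathcal{H})$ is a closed subspace $\mathcal{M}\subseteq\mathcal{H}$ with $S\mathcal{M}\subseteq\mathcal{M}$ and $S^*\mathcal{M}\subseteq\mathcal{M}$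 for all $S\in\mathcal{A}$; the trivial ones are $\{0\}$ and $\mathcal{H}$. *)

(* Defs.v *)
From mathcomp Require Import all_boot all_order all_algebra.
From mathcomp Require Import sesquilinear complex.
From mathcomp Require Import all_classical all_reals all_analysis.

Set Implicit Arguments.
Unset Strict Implicit.
Unset Printing Implicit Defensive.

Import Order.TTheory GRing.Theory Num.Theory.
Import numFieldNormedType.Exports.

Local Open Scope classical_set_scope.
Local Open Scope complex_scope.
Local Open Scope ring_scope.

(* f satisfies the bounded condition when such a finite family Xs exists; members
   of the family may be empty. *)
Definition bounded_partition (X : Type) (f : X -> X) (k : nat)
    (Xs : 'I_k -> set X) : Prop :=
  [/\ trivIset setT Xs, \bigcup_i Xs i = setT & forall i, set_inj (Xs i) f].

Definition orb (X : Type) (f : X -> X) (x : X) : set X :=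
  [set iter n f x | n in [set: nat]].

Definition orbit_equiv (X : Type) (f : X -> X) (x y : X) : Prop :=
  orb f x `&` orb f y !=set0.

Definition subspace_of (K : nzRingType) (V : lmodType K) (M : set V) : Prop :=
  M 0 /\ forall (a : K) (u v : V), M u -> M v -> M (a *: u + v).

Definition lspan (K : nzRingType) (V : lmodType K) (B : set V) : set V :=
  smallest (@subspace_of K V) B.

(* A complex Hilbert space is a complete normed space H over R[i] together with
   an inner product dot (linear in its first argument) inducing the norm of H;
   the norm of the library takes its values in R[i]. *)
Section Hilbert.
Variables (R : realType) (H : completeNormedModType R[i]).
Variable dot : {dot H for Num.conj}.

Definition induces_norm : Prop := forall v : H, `|v| ^+ 2 = dot v v.

Definition orthonormal_basis (X : Type) (e : X -> H) : Prop :=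
  (forall x y, dot (e x) (e y) = `[< x = y >]%:R) /\
  closure (lspan (range e)) = [set: H].

Definition op_bound (T : H -> H) (c : R) : Prop :=
  0 <= c /\ forall v, `|T v| <= c%:C * `|v|.

Definition bounded_op (T : H -> H) : Prop := linear T /\ exists c, op_bound T c.

Definition opnorm (T : H -> H) : R := inf (op_bound T).

(* S = T^*. For bounded T, such an S exists by the Riesz representation theorem, is
   unique, and is itself a bounded operator. *)
Definition is_adjoint (T S : H -> H) : Prop :=
  forall u v, dot (T u) v = dot u (S v).

Definition Cstar_algebra (A : set (H -> H)) : Prop :=
  [/\ A `<=` bounded_op,
      subspace_of A,
      forall S T, A S -> A T -> A (S \o T),
      forall S S', A S -> is_adjoint S S' -> A S' &
      forall (S : nat -> H -> H) (T : H -> H),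
        (forall n, A (S n)) -> bounded_op T ->
        opnorm (S n \- T) @[n --> \oo] --> (0 : R) -> A T].

Definition Cstar_generated (G : set (H -> H)) : set (H -> H) :=
  smallest Cstar_algebra G.

Definition reducing_subspace (A : set (H -> H)) (M : set H) : Prop :=
  [/\ subspace_of M, closed M &
      forall S, A S -> S @` M `<=` M /\
        forall S', is_adjoint S S' -> S' @` M `<=` M].

Definition no_nontrivial_reducing (A : set (H -> H)) : Prop :=
  forall M, reducing_subspace A M -> M = [set 0] \/ M = [set: H].

End Hilbert.

(* Main.v *)
(* For an orbit class [P] the closed span of the [e_z], [z] in [P], contains [e_x]
   for [x] in [P] only, so by hypothesis [P] is everything once this subspace is
   shown to be reducing. Membership is described by the vanishing of the
   coefficients outside [P]. The bounded operators preserving both this subspace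
   and the one of the complement of [P] form a C*-algebra, and it contains each
   [T_i] because [f] preserves [P] and its complement. *)
Require Import Defs.
From mathcomp Require Import all_boot all_order all_algebra.
From mathcomp Require Import sesquilinear complex.
From mathcomp Require Import all_classical all_reals all_analysis.
From mathcomp Require Import ring.

Set Implicit Arguments.
Unset Strict Implicit.
Unset Printing Implicit Defensive.

Import Order.TTheory GRing.Theory Num.Theory.
Import numFieldNormedType.Exports.

Local Open Scope classical_set_scope.
Local Open Scope complex_scope.
Local Open Scope ring_scope.

(** * A vanishing criterion and invariance of orbit classes *)

Lemma norm_eps_eq0 (K : numFieldType) (c z : K) :
  0 <= c -> (forall eps, 0 < eps -> `|z| <= c * eps) -> z = 0.
Proof.
move=> c0 zle; apply/eqP; apply: contraT => z0.
have c1 : 0 < c + 1 by rewrite ltr_wpDl.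
have zgt0 : 0 < `|z| by rewrite normr_gt0.
(* Taking [eps] to be the norm of [z] over [c + 1], not over [c], covers [c = 0]. *)
have := zle _ (divr_gt0 zgt0 c1).
rewrite mulrCA ler_pMr // ler_pdivlMr // mul1r gerDl.
by rewrite ler10.
Qed.

Lemma orbit_equiv_refl (X : Type) (f : X -> X) x : orbit_equiv f x x.
Proof. by exists x; split; exists 0. Qed.

(** A meeting point of the orbits of [x] and [f z] already lies in the orbit of [z]; conversely,
    apply [f] once to a meeting point. Having both directions makes the complement of the class
    invariant too. *)
Lemma orbit_equiv_step (X : Type) (f : X -> X) x z :
  orbit_equiv f x (f z) <-> orbit_equiv f x z.
Proof.
split=> -[w [[n _ nw] [m _ mw]]].
- by exists w; split; [exists n | exists m.+1 => //; rewrite iterSr].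
- exists (f w); split; first by exists n.+1 => //=; rewrite nw.
  by exists m => //; rewrite -iterSr /= mw.
Qed.

(** * Linear spans and their splitting along a set of indices *)

Section LinearSpan.
Variables (K : nzRingType) (V : lmodType K).

Lemma lspan_subspace (B : set V) : subspace_of (lspan B).
Proof.
split=> [M [[M0 _] _]//|a u v Bu Bv M [sM BM]].
by apply: sM.2; [apply: Bu|apply: Bv].
Qed.

Lemma lspan_sub (B M : set V) : subspace_of M -> B `<=` M -> lspan B `<=` M.
Proof. exact: smallest_sub. Qed.

Lemma lspan_image_split (X : Type) (e : X -> V) (P : set X) v :
  lspan (range e) v ->
  exists m n, [/\ lspan (e @` P) m, lspan (e @` ~` P) n & v = m + n].
Proof.
move: v; apply: lspan_sub => [|_ [x _ <-]].
  have [PS PCS] := (lspan_subspace (e @` P), lspan_subspace (e @` ~` P)).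
  split; first by exists 0, 0; split; [exact: PS.1|exact: PCS.1|rewrite addr0].
  move=> a _ _ [m [n [Pm Pn ->]]] [m' [n' [Pm' Pn' ->]]].
  exists (a *: m + m'), (a *: n + n').
  by split; [apply: PS.2|apply: PCS.2|rewrite scalerDr addrACA].
have [Px|Px] := pselect (P x).
- exists (e x), 0; rewrite addr0; split=> //; last exact: (lspan_subspace _).1.
  by apply: sub_gen_smallest; exists x.
- exists 0, (e x); rewrite add0r; split=> //; first exact: (lspan_subspace _).1.
  by apply: sub_gen_smallest; exists x.
Qed.

End LinearSpan.

(** * Cauchy-Schwarz inequality and adjoints *)

Section InnerProduct.
Variables (R : realType) (H : completeNormedModType R[i]).
Variable dot : {dot H for Num.conj}.
Hypothesis dot_norm : induces_norm dot.

Lemma dotC u v : dot u v = (dot v u)^*.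
Proof. by rewrite hermC expr0 mul1r. Qed.

Lemma dotZl a u v : dot (a *: u) v = a * dot u v.
Proof. exact: linearZl_LR. Qed.

Lemma dotZr a u v : dot u (a *: v) = a^* * dot u v.
Proof. exact: linearZr_LR. Qed.

Lemma dot_CauchySchwarz u v : `|dot u v| <= `|u| * `|v|.
Proof.
have [->|v0] := eqVneq v 0; first by rewrite linear0r !normr0 mulr0.
have v2 : 0 < `|v| ^+ 2 by rewrite exprn_gt0 // normr_gt0.
rewrite -(@ler_pXn2r _ 2) ?nnegrE ?mulr_ge0 // exprMn.
(* This vector is [dot v v] times the component of [u] orthogonal to [v]; the scaling avoids a
   division. *)
have := dnorm_ge0 dot (dot v v *: u - dot u v *: v).
have -> : dot (dot v v *: u - dot u v *: v) (dot v v *: u - dot u v *: v) =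
    `|v| ^+ 2 * (`|v| ^+ 2 * `|u| ^+ 2 - dot u v * (dot u v)^*).
  rewrite linearBl /= !linearBr /= !(dotZl, dotZr) -(dotC v u) -(dotC v v) -!dot_norm.
  by ring.
by rewrite pmulr_rge0 // subr_ge0 -normCK mulrC.
Qed.

Lemma dot_eq (u v : H) : (forall w, dot u w = dot v w) -> u = v.
Proof.
move=> uv; apply/eqP; rewrite -subr_eq0 -normr_eq0 -sqrf_eq0 dot_norm.
by rewrite linearBl /= uv subrr.
Qed.

(** Linearity holds because a vector is determined by its inner products. The bound [c] of [S] also
    serves [S']: the square of the norm of [S' v] is [dot (S (S' v)) v], and Cauchy-Schwarz leaves
    one factor to cancel. *)
Lemma adjoint_bounded S S' : bounded_op S -> is_adjoint dot S S' -> bounded_op S'.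
Proof.
move=> [_ [c [c0 Sc]]] adj; split.
  move=> a u v; apply: dot_eq => w.
  by rewrite linearPl /= ![dot _ w]dotC -!adj linearDr /= dotZr rmorphD rmorphM /= conjCK.
exists c; split=> // v.
have [->|S'v0] := eqVneq (S' v) 0; first by rewrite normr0 mulr_ge0 // ler0c.
have S'v : 0 < `|S' v| by rewrite normr_gt0.
rewrite -(ler_pM2l S'v) -expr2 dot_norm -adj.
have dge0 : 0 <= dot (S (S' v)) v by rewrite adj -dot_norm exprn_ge0.
rewrite -(ger0_norm dge0) (le_trans (dot_CauchySchwarz _ _)) //.
by rewrite mulrCA mulrA ler_wpM2r.
Qed.

(** * Vectors supported on a set of basis indices *)

Section OrthonormalBasis.
Variables (X : Type) (e : X -> H).
Hypothesis e_basis : orthonormal_basis dot e.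

Lemma norm_basis x : `|e x| = 1.
Proof.
apply/eqP; rewrite -(@eqrXn2 _ 2) // expr1n dot_norm e_basis.1.
by rewrite asboolT.
Qed.

Definition supported_on (P : set X) : set H :=
  [set v | forall z, ~ P z -> dot v (e z) = 0].

Lemma supported_on_subspace P : subspace_of (supported_on P).
Proof.
split=> [z _|a u v Pu Pv z Pz]; first by rewrite linear0l.
by rewrite linearPl /= Pu // Pv // mulr0 addr0.
Qed.

Lemma supported_on_basis P x : supported_on P (e x) <-> P x.
Proof.
split=> [Px|Px z Pz]; last by rewrite e_basis.1 asboolF // => xz; rewrite xz in Px.
apply: contrapT => /Px /eqP; rewrite e_basis.1 asboolT //.
by rewrite oner_eq0.
Qed.

Lemma supported_on_lspan P : lspan (e @` P) `<=` supported_on P.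
Proof.
apply: lspan_sub; first exact: supported_on_subspace.
by move=> _ [x Px <-]; apply/supported_on_basis.
Qed.

(** Each coefficient is a 1-Lipschitz function of the vector, since basis vectors have norm 1. *)
Lemma supported_on_closed P : closed (supported_on P).
Proof.
move=> v Pv z Pz; apply: (norm_eps_eq0 ler01) => eps eps0.
have [u [Pu]] := Pv _ (nbhsx_ballx v eps eps0).
rewrite -ball_normE /= => /ltW vu.
have -> : dot v (e z) = dot (v - u) (e z) by rewrite linearBl /= (Pu z) // subr0.
by rewrite (le_trans (dot_CauchySchwarz _ _)) // norm_basis mulr1 mul1r.
Qed.

(* If [v = m + n] approximates [w], with [m] and [n] in the spans over [P] and over
   its complement, then so does [m], since [n] is orthogonal to [w - m]. *)
Lemma supported_on_approx P w eps : supported_on P w -> 0 < eps ->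
  exists2 m, lspan (e @` P) m & `|w - m| <= eps.
Proof.
move=> Pw eps0.
have : closure (lspan (range e)) w by rewrite e_basis.2.
move=> /(_ _ (nbhsx_ballx w eps eps0)) [v [/(lspan_image_split P)]].
move=> [m [n [Pm Pn ->]]]; rewrite -ball_normE /= => /ltW wv.
exists m => //; apply: le_trans wv.
have Pwm : supported_on P (w - m).
  have := (supported_on_subspace P).2 (- 1) m w (supported_on_lspan Pm) Pw.
  by rewrite scaleN1r addrC.
have wmn : dot (w - m) n = 0.
  have ker : subspace_of [set u | dot (w - m) u = 0].
    by split=> [|a u u' /= Pu Pu']; rewrite /= ?linear0r // linearPr /= Pu Pu' mulr0 addr0.
  by apply: (lspan_sub ker) Pn => _ [z Pz <-]; apply: Pwm.
rewrite -(@ler_pXn2r _ 2) ?nnegrE // opprD addrA !dot_norm (dnormB dot (w - m) n) /=.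
by rewrite wmn rmorph0 addr0 subr0 lerDl -dot_norm exprn_ge0.
Qed.

(** A bounded functional that kills the [e x] with [x] in [P] kills their span, and the span
    approximates [w] within any [eps]. This reduces later claims to basis vectors. *)
Lemma supported_on_kernel P (phi : H -> R[i]) c w :
  (forall a u v, phi (a *: u + v) = a * phi u + phi v) ->
  0 <= c -> (forall v, `|phi v| <= c * `|v|) ->
  (forall x, P x -> phi (e x) = 0) -> supported_on P w -> phi w = 0.
Proof.
move=> phil c0 phic phiP Pw; apply: (norm_eps_eq0 c0) => eps eps0.
have [m Pm wm] := supported_on_approx Pw eps0.
have phi0 : phi 0 = 0.
  by have := phil (- 1) 0 0; rewrite scaler0 addr0 mulN1r addNr.
have phim : phi m = 0.
  have ker : subspace_of [set u | phi u = 0].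
    by split=> [//|a u v /= Pu Pv]; rewrite phil Pu Pv mulr0 addr0.
  by apply: (lspan_sub ker) Pm => _ [z Pz <-]; apply: phiP.
have -> : phi w = phi (w - m).
  by rewrite addrC -scaleN1r phil phim mulr0 add0r.
by rewrite (le_trans (phic _)) // ler_wpM2l.
Qed.

Lemma supported_on_orthogonal P u v :
  supported_on P u -> supported_on (~` P) v -> dot u v = 0.
Proof.
move=> Pu Pv; apply: (supported_on_kernel (phi := dot^~ v) (c := `|v|) _ _ _ _ Pu) => //.
- by move=> a w w'; rewrite linearPl.
- by move=> w; rewrite mulrC dot_CauchySchwarz.
- by move=> x Px; rewrite dotC Pv ?rmorph0 //= => /(_ Px).
Qed.

(** * Operators preserving supports *)

Lemma supported_on_stable P S : bounded_op S ->
  (forall x, P x -> supported_on P (S (e x))) ->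
  S @` supported_on P `<=` supported_on P.
Proof.
move=> [Sl [c [c0 Sc]]] SP _ [u Pu <-] z Pz.
(* For fixed [z] outside [P], the coefficient of [S w] at [z] is a bounded functional of [w]. *)
apply: (supported_on_kernel (phi := fun w => dot (S w) (e z)) (c := c%:C) _ _ _ _ Pu).
- by move=> a v w; rewrite Sl linearPl.
- by rewrite ler0c.
- by move=> v; rewrite (le_trans (dot_CauchySchwarz _ _)) // norm_basis mulr1.
- by move=> x Px; apply: SP.
Qed.

(** The coefficient of [S' u] at [z] outside [P] is [dot u (S (e z))], and [S (e z)] is supported
    off [P], hence orthogonal to [u]. *)
Lemma adjoint_stable P S S' : is_adjoint dot S S' ->
  S @` supported_on (~` P) `<=` supported_on (~` P) ->
  S' @` supported_on P `<=` supported_on P.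
Proof.
move=> adj SP _ [u Pu <-] z Pz.
rewrite dotC -adj dotC (supported_on_orthogonal Pu) ?rmorph0 //.
by apply: SP; exists (e z) => //; apply/supported_on_basis.
Qed.

(** Both supports are required because passing to the adjoint exchanges them. *)
Definition bi_stable (P : set X) : set (H -> H) :=
  [set S | [/\ bounded_op S, S @` supported_on P `<=` supported_on P &
               S @` supported_on (~` P) `<=` supported_on (~` P)]].

(** The norm is an infimum of admissible constants, so a strict inequality yields one of them below
    [eps]. *)
Lemma opnorm_lt (S : H -> H) eps : bounded_op S -> opnorm S < eps ->
  forall v, `|S v| <= eps%:C * `|v|.
Proof.
move=> [_ Sb] /(inf_lt Sb) [c [c0 Sc] ceps] v.
by rewrite (le_trans (Sc v)) // ler_wpM2r // lecR ltW.
Qed.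

Lemma bounded_op_comb (a : R[i]) (S T : H -> H) : bounded_op S -> bounded_op T ->
  bounded_op (a *: S + T).
Proof.
move=> [Sl [c [c0 Sc]]] [Tl [d [d0 Td]]]; split.
  move=> b u v; rewrite !fctE /= Sl Tl !scalerDr !scalerA [a * b]mulrC.
  by rewrite addrACA.
(* The norm of [a] is a real element of [R[i]]; its real part turns it into a constant in [R]. *)
exists (complex.Re `|a| * c + d).
have a0 : (complex.Re `|a|)%:C = `|a| by rewrite RRe_real ?normr_real.
split; first by rewrite addr_ge0 // mulr_ge0 // -ler0c a0.
move=> v; rewrite rmorphD rmorphM /= a0 mulrDl.
rewrite (le_trans (ler_normD _ _)) // lerD // fctE normrZ -mulrA.
by rewrite ler_wpM2l.
Qed.

(** Outside [P] the vector [S n u] has no coefficients, so those of [T u] are, up to sign, those of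
    [(S n \- T) u], which are arbitrarily small. *)
Lemma stable_limit P (S : nat -> H -> H) T :
  (forall n, bounded_op (S n)) -> bounded_op T ->
  opnorm (S n \- T) @[n --> \oo] --> (0 : R) ->
  (forall n, S n @` supported_on P `<=` supported_on P) ->
  T @` supported_on P `<=` supported_on P.
Proof.
move=> Sb Tb ST SP _ [u Pu <-] z Pz.
apply: (norm_eps_eq0 (normr_ge0 u)) => eps eps0.
have epsE : (complex.Re eps)%:C = eps by rewrite RRe_real ?gtr0_real.
have : 0 < complex.Re eps by rewrite -ltcR epsE.
move=> /(cvgr_lt _ ST) [N _ /(_ N (leqnn N))] /= STN.
have STb : bounded_op (S N \- T).
  have := bounded_op_comb (- 1) Tb (Sb N).
  by rewrite scaleN1r addrC.
have := opnorm_lt STb STN u; rewrite epsE => le_eps.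
have -> : dot (T u) (e z) = - dot ((S N \- T) u) (e z).
  rewrite linearBl /= opprB (SP N (S N u)) ?subr0 //; by exists u.
rewrite normrN (le_trans (dot_CauchySchwarz _ _)) // norm_basis mulr1.
by rewrite mulrC.
Qed.

Lemma bi_stable_Cstar P : Cstar_algebra dot (bi_stable P).
Proof.
have subP := supported_on_subspace.
split.
- by move=> S [].
- split.
    split; last 2 first.
    + by move=> _ [u _ <-]; apply: (subP _).1.
    + by move=> _ [u _ <-]; apply: (subP _).1.
    split; first by move=> a u v; rewrite /= scaler0 addr0.
    by exists 0; split=> // v; rewrite mul0r normr0.
  move=> a S T [Sb SP SPc] [Tb TP TPc]; split; first exact: bounded_op_comb.
  + move=> _ [u Pu <-]; apply: (subP _).2; [apply: SP|apply: TP]; by exists u.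
  + move=> _ [u Pu <-]; apply: (subP _).2; [apply: SPc|apply: TPc]; by exists u.
- move=> S T [[Sl [c [c0 Sc]]] SP SPc] [[Tl [d [d0 Td]]] TP TPc]; split.
  + split; first by move=> a u v /=; rewrite Tl Sl.
    exists (c * d); split; first exact: mulr_ge0.
    move=> v /=; rewrite (le_trans (Sc _)) // rmorphM -mulrA.
    by rewrite ler_wpM2l ?ler0c.
  + by move=> _ [u Pu <-]; apply: SP; exists (T u) => //; apply: TP; exists u.
  + by move=> _ [u Pu <-]; apply: SPc; exists (T u) => //; apply: TPc; exists u.
- move=> S S' [Sb SP SPc] adj; split; first exact: adjoint_bounded adj.
  + exact: adjoint_stable adj SPc.
  (* For the complement of [P], the hypothesis on [S] concerns the double complement, which is
     [P]. *)
  + by apply: adjoint_stable adj _; rewrite setCK.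
- move=> S T SA Tb ST; have Sb n : bounded_op (S n) by case: (SA n).
  split=> //; apply: stable_limit ST _ => // n; by case: (SA n).
Qed.

Lemma supported_on_reducing P (G : set (H -> H)) : G `<=` @bounded_op R H ->
  (forall S x, G S -> P x -> supported_on P (S (e x))) ->
  (forall S x, G S -> ~ P x -> supported_on (~` P) (S (e x))) ->
  reducing_subspace dot (Cstar_generated dot G) (supported_on P).
Proof.
move=> Gb GP GPc; split; first exact: supported_on_subspace.
  exact: supported_on_closed.
(* By minimality of the generated algebra, only the generators need checking, and for them only the
   basis vectors. *)
have Gsub : Cstar_generated dot G `<=` bi_stable P.
  apply: smallest_sub; first exact: bi_stable_Cstar.
  by move=> S GS; split; [exact: Gb| |];
    apply: supported_on_stable => [|x Px]; [exact: Gb|exact: GP|exact: Gb|exact: GPc].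
move=> S /Gsub [_ SP SPc]; split=> // S' adj.
exact: adjoint_stable adj SPc.
Qed.

End OrthonormalBasis.
End InnerProduct.

Theorem corollary5p1p9
  (X : Type) (Xcountable : countable [set: X]) (Xinfinite : infinite_set [set: X])
  (f : X -> X)
  (k : nat) (k_ge1 : (1 <= k)%N)
  (Xs : 'I_k -> set X) (fXs : bounded_partition f Xs)
  (R : realType) (H : completeNormedModType R[i])
  (dot : {dot H for Num.conj}) (dot_norm : induces_norm dot)
  (e : X -> H) (e_basis : orthonormal_basis dot e)
  (T : 'I_k -> H -> H) (T_bounded : forall i, bounded_op (T i))
  (T_basis : forall i x, T i (e x) = if x \in Xs i then e (f x) else 0)
  (no_reducing : no_nontrivial_reducing dot (Cstar_generated dot (range T))) :
  forall x y : X, orbit_equiv f x y.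
Proof.
move=> x y; set P : set X := orbit_equiv f x.
(* [Q] is kept general to serve both for [P] and for its complement. *)
have TP (Q : set X) i z : (forall z, Q (f z) <-> Q z) -> Q z ->
    supported_on dot e Q (T i (e z)).
  move=> Qf Qz; rewrite T_basis; case: ifP => _; last exact: (supported_on_subspace _ _ _).1.
  by apply/(supported_on_basis e_basis)/Qf.
have Pf z : P (f z) <-> P z := orbit_equiv_step f x z.
have Pred : reducing_subspace dot (Cstar_generated dot (range T))
    (supported_on dot e P).
  apply: supported_on_reducing => // [_ [i _ <-]//|_ z [i _ <-]|_ z [i _ <-]].
  - exact: TP.
  - by apply: TP => z'; split; apply: contra_not => /Pf.
have Px : supported_on dot e P (e x).
  by apply/(supported_on_basis e_basis)/orbit_equiv_refl.
(* The zero subspace is excluded by the unit vector [e x]; otherwise [e y] is supported on [P],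
   which forces [y] into the class of [x]. *)
have [P0|PT] := no_reducing _ Pred.
- move: Px; rewrite P0 /= => ex0; have /eqP := norm_basis dot_norm e_basis x.
  by rewrite ex0 normr0 eq_sym oner_eq0.
- by apply/(supported_on_basis e_basis); rewrite PT.
Qed.
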